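(* Let $u,v$ be hermitian linear functionals on the space $\Lambda$ of complex Laurent polynomials, with Carathéodory series $F$ and $G$ respectively. If $u$ and $v$ are related by a rational modification, i.e. there exist $L,M\in\Lambda\setminus\{0\}$ with $uL=vM$, then $u$ and $v$ are related by a linear spectral transformation, i.e. there exist $\tilde L,\tilde M\in\Lambda\setminus\{0\}$ and $C\in\Lambda$ such that $F\tilde L=G\tilde M+C$.
   Context: $\Lambda=\mathbb{C}[z,z^{-1}]$ is the ring of complex Laurent polynomials. $\Lambda'=\operatorname{Hom}(\Lambda,\mathbb{C})$ is its (algebraic) dual space. For $u\in\Lambda'$ and $L\in\Lambda$, the functional $uL\in\Lambda'$ is defined by $uL[f]=u[Lf]$. A functional $u\in\Lambda'$ with moments $\mu_n=u[z^n]$, $n\in\mathbb{Z}$, is called hermitian if $\mu_{-n}=\overline{\mu_n}$ for all $n\in\mathbb{Z}$. The Carathéodory series of a hermitian $u$ is the formal power series $F(z)=\mu_0+2\sum_{n\ge 1}\mu_{-n}z^n$. Identities such as $FL=GM+C$ with $L,M,C\in\Lambda$ are identities of formal Laurent series with finitely many negative powers of $z$. *)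

(* Defs.v *)
From HB Require Import structures.
From mathcomp Require Import all_boot all_order all_algebra.
From mathcomp Require Import finmap monalg.
From mathcomp Require Import boolp reals complex.

Set Implicit Arguments.
Unset Strict Implicit.
Unset Printing Implicit Defensive.

Import Order.TTheory GRing.Theory Num.Theory.
Local Open Scope fset_scope.
Local Open Scope ring_scope.
Local Open Scope complex_scope.

(* monalg only multiplies over a monomType, which may not contain non-trivial
   invertible elements; hence an alias of the free module on int, with the
   group-algebra product constructed here. *)
Definition laurent (K : comNzRingType) : Type := {malg K[int]}.

HB.instance Definition _ (K : comNzRingType) := GRing.Lmodule.on (laurent K).

Definition zpow (K : comNzRingType) (n : int) : laurent K := << n >>.

Definition lcoef (K : comNzRingType) (n : int) (f : laurent K) : K :=
  mcoeff n f.

Definition lmul (K : comNzRingType) (f g : laurent K) : laurent K :=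
  \sum_(i <- msupp f) \sum_(j <- msupp g)
    (<< lcoef i f * lcoef j g *g (i + j)%R >> : laurent K).

Section LaurentRing.
Context {K : comNzRingType}.
Implicit Types f g h : laurent K.

Lemma lmulw (d1 d2 : {fset int}) f g :
  msupp f `<=` d1 -> msupp g `<=` d2 ->
  lmul f g = \sum_(i <- d1) \sum_(j <- d2)
    (<< lcoef i f * lcoef j g *g (i + j)%R >> : laurent K).
Proof.
move=> le_d1 le_d2; rewrite /lmul (big_fset_incl _ le_d1) /=.
  apply/eq_bigr=> k1 _; apply/big_fset_incl => // k _ /mcoeff_outdom.
  by rewrite /lcoef => ->; rewrite mulr0 monalgU0.
move=> k _ /mcoeff_outdom f0.
by rewrite big1 => // k' _; rewrite /lcoef f0 mul0r monalgU0.
Qed.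

Lemma lmulUU (a b : K) (i j : int) :
  lmul << a *g i >> << b *g j >> = << a * b *g (i + j)%R >>.
Proof.
by rewrite (lmulw msuppU_le msuppU_le) !big_seq_fset1 /lcoef !mcoeffUU.
Qed.

Lemma lmulC : commutative (@lmul K).
Proof.
move=> f g; rewrite /lmul exchange_big /=; apply/eq_bigr=> j _.
by apply/eq_bigr=> i _; rewrite mulrC addrC.
Qed.

Lemma lmulDl : left_distributive (@lmul K) +%R.
Proof.
move=> f g h.
rewrite [in RHS](lmulw (fsubsetUl _ (msupp g)) (fsubset_refl _)).
rewrite [in RHS](lmulw (fsubsetUr (msupp f) _) (fsubset_refl _)).
rewrite (lmulw (msuppD_le _ _) (fsubset_refl _)) -big_split /=.
apply/eq_bigr=> i _; rewrite -big_split /=; apply/eq_bigr=> j _.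
by rewrite /lcoef mcoeffD mulrDl monalgUD.
Qed.

Lemma lmulDr : right_distributive (@lmul K) +%R.
Proof. by move=> f g h; rewrite !(lmulC f) lmulDl. Qed.

Lemma lmul0l : left_zero 0 (@lmul K).
Proof. by move=> f; rewrite /lmul msupp0 big_seq_fset0. Qed.

Lemma lmul_suml (I : Type) (r : seq I) (F : I -> laurent K) g :
  lmul (\sum_(i <- r) F i) g = \sum_(i <- r) lmul (F i) g.
Proof.
exact: (big_morph (fun f => lmul f g) (fun _ _ => lmulDl _ _ _) (lmul0l _)).
Qed.

Lemma lmul_sumr (I : Type) (r : seq I) (F : I -> laurent K) g :
  lmul g (\sum_(i <- r) F i) = \sum_(i <- r) lmul g (F i).
Proof. by rewrite lmulC lmul_suml; apply: eq_bigr => i _; rewrite lmulC. Qed.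

Lemma lmulA : associative (@lmul K).
Proof.
move=> f g h; rewrite (monalgE f) (monalgE g) (monalgE h).
rewrite [LHS]lmul_suml [X in _ = lmul X _]lmul_suml [RHS]lmul_suml.
apply: eq_bigr => i _.
rewrite [X in lmul _ X = _]lmul_suml [LHS]lmul_sumr.
rewrite [X in _ = lmul X _]lmul_sumr [RHS]lmul_suml.
apply: eq_bigr => j _.
rewrite [X in lmul _ X = _]lmul_sumr [LHS]lmul_sumr [RHS]lmul_sumr.
apply: eq_bigr => k _.
by rewrite !lmulUU mulrA addrA.
Qed.

Lemma lmul1l : left_id (zpow K 0) (@lmul K).
Proof.
move=> f; rewrite [in LHS](monalgE f) lmul_sumr [RHS]monalgE.
by apply: eq_bigr => i _; rewrite lmulUU mul1r add0r.
Qed.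

Lemma zpow0_neq0 : zpow K 0 != 0.
Proof. by rewrite monalgU_eq0 oner_eq0. Qed.

End LaurentRing.

HB.instance Definition _ (K : comNzRingType) :=
  GRing.Zmodule_isComNzRing.Build (laurent K)
    lmulA lmulC lmul1l lmulDl zpow0_neq0.

Lemma zpowD (K : comNzRingType) (m n : int) :
  zpow K (m + n) = zpow K m * zpow K n.
Proof. by rewrite [RHS]lmulUU mulr1. Qed.

Lemma lscaleAl (K : comNzRingType) (a : K) (f g : laurent K) :
  a *: (f * g) = a *: f * g.
Proof.
rewrite ![_ * _](@lmulw _ (msupp f) (msupp g)) ?msuppZ_le //.
rewrite scaler_sumr; apply: eq_bigr => i _.
rewrite scaler_sumr; apply: eq_bigr => j _.
by apply/malgP => k; rewrite /lcoef !mcoeffsE -mulrnAr mulrA mulrnAr.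
Qed.

HB.instance Definition _ (K : comNzRingType) :=
  GRing.Lmodule_isLalgebra.Build K (laurent K) (@lscaleAl K).
HB.instance Definition _ (K : comNzRingType) :=
  GRing.Lalgebra_isComAlgebra.Build K (laurent K).

Definition fun_mul (K : comNzRingType) (u : {scalar laurent K})
  (L : laurent K) (f : laurent K) : K := u (L * f).

Lemma fun_mul_is_linear (K : comNzRingType) (u : {scalar laurent K})
  (L : laurent K) : scalar (fun_mul u L).
Proof. by move=> a f g; rewrite /fun_mul mulrDr -scalerAr linearP. Qed.

HB.instance Definition _ (K : comNzRingType) (u : {scalar laurent K})
    (L : laurent K) :=
  GRing.isLinear.Build K (laurent K) K *%R (fun_mul u L)
    (fun_mul_is_linear u L).

Definition moment (K : comNzRingType) (u : {scalar laurent K}) (n : int) : K :=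
  u (zpow K n).

Definition hermitian_functional (R : realType) (u : {scalar laurent R[i]}) :=
  forall n : int, moment u (- n) = (moment u n)^*.

Definition rational_modification (K : comNzRingType)
    (u v : {scalar laurent K}) : Prop :=
  exists L M : laurent K,
    [/\ L != 0, M != 0 & fun_mul u L =1 fun_mul v M].

Record laurent_series (K : comNzRingType) := LaurentSeries {
  scoef : int -> K;
  scoef_bounded : exists N : int, forall n : int, n < N -> scoef n = 0
}.

Lemma laurent_seriesP (K : comNzRingType) (F G : laurent_series K) :
  (forall n, scoef F n = scoef G n) <-> F = G.
Proof.
split=> [|-> //]; case: F G => [f fP] [g gP] /= /funext fg.
by rewrite fg in fP *; rewrite (Prop_irrelevance fP gP).
Qed.

Lemma lower_bound_seq (s : seq int) :
  exists m : int, forall k, k \in s -> m <= k.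
Proof.
elim: s => [|a s [m IH]]; first by exists 0.
exists (Num.min a m) => k; rewrite inE ge_min => /orP[/eqP->|/IH ->].
  by rewrite lexx.
by rewrite orbT.
Qed.

Section SeriesOperations.
Context {K : comNzRingType}.

Lemma series_of_subproof (L : laurent K) :
  exists N : int, forall n, n < N -> lcoef n L = 0.
Proof.
have [m mP] := lower_bound_seq (msupp L).
exists m => n ltnm; apply/eqP; rewrite mcoeff_eq0.
by apply/negP => /mP; rewrite leNgt ltnm.
Qed.

Definition series_of (L : laurent K) : laurent_series K :=
  @LaurentSeries K (fun n => lcoef n L) (series_of_subproof L).

Lemma series_add_subproof (F G : laurent_series K) :
  exists N : int, forall n, n < N -> scoef F n + scoef G n = 0.
Proof.
case: F G => [f [N fN]] [g [P gP]] /=; exists (Num.min N P) => n.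
by rewrite lt_min => /andP[/fN -> /gP ->]; rewrite addr0.
Qed.

Definition series_add (F G : laurent_series K) : laurent_series K :=
  @LaurentSeries K (fun n => scoef F n + scoef G n) (series_add_subproof F G).

Lemma series_mul_subproof (F : laurent_series K) (L : laurent K) :
  exists N : int, forall n, n < N ->
    \sum_(k <- msupp L) scoef F (n - k) * lcoef k L = 0.
Proof.
have [m mP] := lower_bound_seq (msupp L); case: F => [f [N fN]] /=.
exists (N + m) => n ltn; rewrite big_seq big1 // => k /mP lemk.
by rewrite fN ?mul0r // ltrBlDr (lt_le_trans ltn) // lerD2l.
Qed.

Definition series_mul (F : laurent_series K) (L : laurent K) :
  laurent_series K :=
  @LaurentSeries K (fun n => \sum_(k <- msupp L) scoef F (n - k) * lcoef k L)
    (series_mul_subproof F L).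

Lemma series_ofM (L M : laurent K) :
  series_of (L * M) = series_mul (series_of L) M.
Proof.
apply/laurent_seriesP => n /=; rewrite [L * M]lmulC /lmul /lcoef raddf_sum /=.
apply: eq_bigr => k _; rewrite raddf_sum /=.
under eq_bigr => j _.
  rewrite mcoeffU mulrC -mulrnAl addrC -subr_eq0 -addrA -(opprB n k).
  rewrite subr_eq0.
  over.
rewrite -mulr_suml; congr (_ * _).
rewrite [in RHS](monalgE L) raddf_sum /=.
by apply: eq_bigr => j _; rewrite mcoeffU.
Qed.

End SeriesOperations.

Definition caratheodory_coef (K : comNzRingType) (u : {scalar laurent K})
    (n : int) : K :=
  if n == 0 then moment u 0 else if 0 < n then 2 * moment u (- n) else 0.

Lemma caratheodory_subproof (K : comNzRingType) (u : {scalar laurent K}) :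
  exists N : int, forall n, n < N -> caratheodory_coef u n = 0.
Proof.
by exists 0 => n n0; rewrite /caratheodory_coef lt_eqF // ltNge ltW.
Qed.

Definition caratheodory (K : comNzRingType) (u : {scalar laurent K}) :
  laurent_series K := LaurentSeries (caratheodory_subproof u).

Definition spectral_transformation (K : comNzRingType)
    (F G : laurent_series K) : Prop :=
  exists L M C : laurent K,
    [/\ L != 0, M != 0 &
      series_mul F L = series_add (series_mul G M) (series_of C)].

(* Main.v *)
Require Import Defs.
From mathcomp Require Import all_boot all_order all_algebra.
From mathcomp Require Import reals complex.
From mathcomp Require Import finmap monalg.
Import Order.TTheory GRing.Theory Num.Theory.

Local Open Scope ring_scope.
Local Open Scope complex_scope.

(** The coefficient of [z^n] in [FL] is [\sum_k F_(n-k) L_k].  Once [n] exceeds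
    every exponent of [L], only the coefficients [F_m = 2 mu_(-m)] with [m > 0]
    occur and the sum equals [2 (uL)[z^(-n)]].  Hence [FL] and [GM] agree in
    all large degrees, both vanish in very negative degrees, and their
    difference is a Laurent polynomial: [L] and [M] themselves serve as the new
    multipliers. *)

Section SeriesFacts.
Context {K : comNzRingType}.

Lemma monomial_scale (a : K) (n : int) :
  (<< a *g n >> : laurent K) = a *: zpow K n.
Proof. by apply/malgP => k; rewrite mcoeffZ !mcoeffU mulrnAr mulr1. Qed.

Lemma fun_mul_zpow (u : {scalar laurent K}) (L : laurent K) (n : int) :
  fun_mul u L (zpow K n) =
    \sum_(k <- msupp L) lcoef k L * moment u (k + n).
Proof.
rewrite /fun_mul [in LHS](monalgE L) mulr_suml linear_sum /=.
apply: eq_bigr => k _.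
by rewrite monomial_scale -scalerAl -zpowD linearZ.
Qed.

Lemma upper_bound_seq (s : seq int) :
  exists m : int, forall k, k \in s -> k <= m.
Proof.
have [m mP] := lower_bound_seq (map -%R s).
by exists (- m) => k ks; rewrite lerNr mP ?map_f.
Qed.

Lemma caratheodory_mul_large (u : {scalar laurent K}) (L : laurent K) :
  exists N : int, forall n, N < n ->
    scoef (series_mul (caratheodory u) L) n = 2 * fun_mul u L (zpow K (- n)).
Proof.
have [N NP] := upper_bound_seq (msupp L); exists N => n ltNn /=.
rewrite fun_mul_zpow mulr_sumr big_seq [RHS]big_seq.
apply: eq_bigr => k /NP lekN.
(* Strict positivity matters: the coefficient in degree [0] is [mu_0], without the factor [2]. *)
have nk_gt0 : 0 < n - k by rewrite subr_gt0 (le_lt_trans lekN).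
rewrite /caratheodory_coef gt_eqF // nk_gt0 opprB -mulrA.
by congr (_ * _); rewrite mulrC.
Qed.

Lemma laurent_of_bounded_support (c : int -> K) (N P : int) :
  (forall n, n < N -> c n = 0) -> (forall n, P < n -> c n = 0) ->
  exists C : laurent K, forall n, lcoef n C = c n.
Proof.
move=> cN cP.
(* The [m] exponents from [N] to [N + |P - N|] include every degree in which [c] can be nonzero. If
   [P < N], then [c] is zero everywhere and the monomials summed all vanish. *)
pose m := `|P - N|.+1%N.
exists (\sum_(i < m) << c (N + i%:Z) *g N + i%:Z >>) => n.
rewrite /lcoef raddf_sum /=.
under eq_bigr do rewrite mcoeffU.
have [ltnN|leNn] := ltP n N.
  rewrite cN // big1 // => i _.
  by rewrite gt_eqF ?mulr0n // (lt_le_trans ltnN) // lerDl.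
have [j def_n] : exists j : nat, n = N + j%:Z.
  by exists `|n - N|%N; rewrite gez0_abs ?subr_ge0 // subrKC.
have eqNi i : (N + i%:Z == n) = (i == j).
  by rewrite def_n (inj_eq (addrI N)).
have [ltjm|lemj] := ltnP j m.
  rewrite (bigD1 (Ordinal ltjm)) //= eqNi eqxx -def_n big1 ?addr0 // => i.
  by rewrite -val_eqE eqNi /= => /negPf ->.
(* Here [j] exceeds [|P - N|], hence [P - N], so [n = N + j] lies above [P]. *)
rewrite cP; last first.
  by rewrite def_n -ltrBlDl (le_lt_trans (lez_abs _)).
rewrite big1 // => i _.
by rewrite eqNi ltn_eqF ?mulr0n // (leq_trans (ltn_ord i)).
Qed.

Lemma series_eq_mod_laurent (F G : laurent_series K) (P : int) :
  (forall n, P < n -> scoef F n = scoef G n) ->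
  exists C : laurent K, F = series_add G (series_of C).
Proof.
move=> eqFG; have [N FN] := scoef_bounded F; have [N' GN'] := scoef_bounded G.
(* Below [Num.min N N'] both series vanish; above [P] they agree. So their difference has finite
   support and is the required [C]. *)
have [||C defC] := @laurent_of_bounded_support
    (fun n => scoef F n - scoef G n) (Num.min N N') P.
- by move=> n; rewrite lt_min => /andP[/FN -> /GN' ->]; rewrite subr0.
- by move=> n /eqFG ->; rewrite subrr.
by exists C; apply/laurent_seriesP => n /=; rewrite defC addrC subrK.
Qed.

End SeriesFacts.

Theorem proposition2p3 (R : realType) (u v : {scalar laurent R[i]})
    (hu : hermitian_functional u) (hv : hermitian_functional v) :
  rational_modification u v ->
  spectral_transformation (caratheodory u) (caratheodory v).
Proof.
move=> [L [M [L0 M0 uLvM]]].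
have [N FN] := caratheodory_mul_large u L.
have [P GP] := caratheodory_mul_large v M.
have [n|C defC] := @series_eq_mod_laurent _
    (series_mul (caratheodory u) L) (series_mul (caratheodory v) M)
    (Num.max N P).
  (* Past both thresholds, the hypothesis is used only at the monomials [z^(-n)]. *)
  by rewrite gt_max => /andP[/FN -> /GP ->]; rewrite uLvM.
by exists L, M, C.
Qed.
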